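(* Let $\mathbf{k}$ be an algebraically closed field of characteristic zero and let $\Delta$ be a simplicial complex on $[n]$. A vector $\alpha\in\mathbb Z^n$ is the degree of a nonzero $\mathbb Z^n$-homogeneous locally nilpotent derivation of $\mathbf k[\Delta]$ if and only if $\alpha$ is a Demazure root of $\Delta$, i.e. $\alpha\in\mathcal R(\Delta)$. Equivalently, $$\mathcal R(\Delta)=\bigl\{\beta-\mathbf e_i: i\in[n],\ \beta\in\mathbb Z^n_{\ge0},\ \beta_i=0,\ \emptyset\ne\mathcal F_{\operatorname{supp}(\beta)}(\Delta)\subseteq\mathcal F_i(\Delta)\bigr\}.$$
   Context: $\mathbf{k}$ is an algebraically closed field of characteristic zero. For $n\ge 1$, $[n]=\{1,\dots,n\}$. A simplicial complex $\Delta$ on $[n]$ is a collection of subsets of $[n]$ (faces) closed under taking subsets; it is always assumed that $\{i\}\in\Delta$ for every $i\in[n]$. Facets are the inclusion-maximal faces; $\mathcal F(\Delta)$ is the set of facets, $\mathcal F_\sigma(\Delta)=\{F\in\mathcal F(\Delta):\sigma\subseteq F\}$ for any $\sigma\subseteq[n]$, and $\mathcal F_i(\Delta)=\mathcal F_{\{i\}}(\Delta)$. For a face $S$, $\operatorname{cl}(S)=\bigcap_{F\in\mathcal F_S(\Delta)}F$. For $i\in[n]$, $\mathcal A_i(\Delta)=\{S\subseteq[n]\setminus\{i\}: S\in\Delta,\ i\in\operatorname{cl}(S)\}$. With $\mathbf e_i$ the standard basis vectors of $\mathbb Z^n$ and $\operatorname{supp}(a)=\{i:a_i\neq0\}$,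 the set of Demazure roots of $\Delta$ is, by definition, $\mathcal R(\Delta)=\{\beta-\mathbf e_i: i\in[n],\ \beta\in\mathbb Z^n_{\ge0},\ \beta_i=0,\ \operatorname{supp}(\beta)\in\mathcal A_i(\Delta)\}$. $\mathbf k[\Delta]=\mathbf k[x_1,\dots,x_n]/I_\Delta$ with $I_\Delta=(\prod_{i\in\sigma}x_i:\sigma\subseteq[n],\sigma\notin\Delta)$. It has $\mathbf k$-basis the monomials $\overline{\mathbf x}^a$ with $a\in\mathbb Z^n_{\ge0}$, $\operatorname{supp}(a)\in\Delta$, and is $\mathbb Z^n$-graded with pieces $\overline B_a=\mathbf k\,\overline{\mathbf x}^a$ for such $a$ and $\overline B_a=0$ otherwise. A derivation ($\mathbf k$-linear, satisfying the Leibniz rule) $\partial$ of $\mathbf k[\Delta]$ is locally nilpotent if for every $f$ there is $k\ge1$ with $\partial^k(f)=0$; it is $\mathbb Z^n$-homogeneous of degree $\alpha\in\mathbb Z^n$ if $\partial(\overline B_a)\subseteq\overline B_{a+\alpha}$ for all $a\in\mathbb Z^n$. *)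

(* Defs.v *)
From HB Require Import structures.
From mathcomp Require Import all_boot all_order all_algebra.
From mathcomp Require Import boolp.
From mathcomp Require Import mpoly.

Set Implicit Arguments.
Unset Strict Implicit.
Unset Printing Implicit Defensive.

Import Order.TTheory GRing.Theory Num.Theory.
Local Open Scope ring_scope.
Local Open Scope quotient_scope.

(* The vertex set [n] is 'I_n; vectors of Z^n are rows 'rV[int]_n. *)

(* For 0 < n, [empty_face] follows from the two other axioms. *)
Record simplicial_complex (n : nat) := SimplicialComplex {
  faces : {set {set 'I_n}};
  empty_face : set0 \in faces;
  face_subset : forall S T : {set 'I_n}, T \subset S -> S \in faces -> T \in faces;
  vertex_face : forall i : 'I_n, [set i] \in faces
}.

Section Combinatorics.
Variables (n : nat) (Delta : simplicial_complex n).

Definition facets : {set {set 'I_n}} :=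
  [set F : {set 'I_n} | maxset (fun S : {set 'I_n} => S \in faces Delta) F].

Definition facets_over (S : {set 'I_n}) : {set {set 'I_n}} :=
  [set F in facets | S \subset F].

Definition cl (S : {set 'I_n}) : {set 'I_n} := \bigcap_(F in facets_over S) F.

Definition roots_support (i : 'I_n) : {set {set 'I_n}} :=
  [set S : {set 'I_n} | [&& S \subset [set~ i], S \in faces Delta & i \in cl S]].

End Combinatorics.

Definition supp (n : nat) (a : 'rV[int]_n) : {set 'I_n} := [set i | a 0 i != 0].

Definition nonneg (n : nat) (a : 'rV[int]_n) : bool := [forall i, 0 <= a 0 i].

Definition unit_vec (n : nat) (i : 'I_n) : 'rV[int]_n := delta_mx 0 i.

Definition demazure_root (n : nat) (Delta : simplicial_complex n)
    (alpha : 'rV[int]_n) : Prop :=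
  exists (i : 'I_n) (beta : 'rV[int]_n),
    [/\ nonneg beta, beta 0 i = 0, supp beta \in roots_support Delta i
      & alpha = beta - unit_vec i].

Section StanleyReisner.
Variables (k : fieldType) (n : nat) (Delta : simplicial_complex n).

(* The ideal generated by the squarefree monomials of the non-faces. *)
Definition sr_ideal : {pred {mpoly k[n]}} := fun p =>
  `[< exists q : {set 'I_n} -> {mpoly k[n]},
        p = \sum_(S : {set 'I_n} | S \notin faces Delta)
              q S * \prod_(i in S) 'X_i >].

Lemma sr_ideal_closed : idealr_closed sr_ideal.
Proof.
split.
- apply/asboolP; exists (fun=> 0).
  by rewrite big1 // => S _; rewrite mul0r.
- apply/asboolP => -[q /(congr1 (meval (fun=> 0)))].
  rewrite meval1 raddf_sum big1 => [/eqP|S SnD]; first by rewrite oner_eq0.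
  have [i iS] : exists i, i \in S.
    by apply/set0Pn; apply: contraNneq SnD => ->; apply: empty_face.
  by rewrite /= mevalM (bigD1 i) //= mevalM mevalXU mul0r mulr0.
- move=> a u v /asboolP [q ->] /asboolP [r ->]; apply/asboolP.
  exists (fun S => a * q S + r S).
  rewrite big_distrr /= -big_split /=; apply: eq_bigr => S _.
  by rewrite mulrDl mulrA.
Qed.

HB.instance Definition _ := isIdealr.Build {mpoly k[n]} sr_ideal sr_ideal_closed.

Definition sr_ring := {ideal_quot sr_ideal}.

HB.instance Definition _ := GRing.ComNzRing.on sr_ring.

Definition sr_pi (p : {mpoly k[n]}) : sr_ring := \pi p.

Definition sr_scale (c : k) (f : sr_ring) : sr_ring := sr_pi c%:MP * f.

Lemma sr_scaleA c d f : sr_scale c (sr_scale d f) = sr_scale (c * d) f.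
Proof. by rewrite /sr_scale /sr_pi mpolyCM rmorphM mulrA. Qed.

Lemma sr_scale1 : left_id 1 sr_scale.
Proof. by move=> f; rewrite /sr_scale /sr_pi mpolyC1 rmorph1 mul1r. Qed.

Lemma sr_scaleDr : right_distributive sr_scale +%R.
Proof. by move=> c f g; rewrite /sr_scale mulrDr. Qed.

Lemma sr_scaleDl f : {morph sr_scale^~ f : c d / c + d}.
Proof. by move=> c d; rewrite /sr_scale /sr_pi mpolyCD rmorphD mulrDl. Qed.

HB.instance Definition _ := GRing.Zmodule_isLmodule.Build k sr_ring
  sr_scaleA sr_scale1 sr_scaleDr sr_scaleDl.

Lemma sr_scaleAl (c : k) (f g : sr_ring) : c *: (f * g) = c *: f * g.
Proof. exact: mulrA. Qed.

HB.instance Definition _ := GRing.Lmodule_isLalgebra.Build k sr_ring sr_scaleAl.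

Lemma sr_scaleAr (c : k) (f g : sr_ring) : c *: (f * g) = f * (c *: g).
Proof. exact: mulrCA. Qed.

HB.instance Definition _ := GRing.Lalgebra_isAlgebra.Build k sr_ring sr_scaleAr.

(* Only meaningful for nonnegative [a]. *)
Definition sr_monomial (a : 'rV[int]_n) : sr_ring :=
  sr_pi 'X_[[multinom absz (a 0%R i) | i < n]].

Definition graded_piece (a : 'rV[int]_n) (f : sr_ring) : Prop :=
  if nonneg a && (supp a \in faces Delta)
  then exists c : k, f = c *: sr_monomial a
  else f = 0.

End StanleyReisner.

Section Derivations.
Variables (k : fieldType) (n : nat) (Delta : simplicial_complex n).
Implicit Types D : {linear sr_ring k Delta -> sr_ring k Delta}.

Definition derivation D : Prop := forall f g, D (f * g) = D f * g + f * D g.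

Definition locally_nilpotent D : Prop :=
  forall f, exists m : nat, (0 < m)%N /\ iter m D f = 0.

Definition homogeneous (alpha : 'rV[int]_n) D : Prop :=
  forall a f, graded_piece a f -> graded_piece (a + alpha) (D f).

End Derivations.

(* Main.v *)
From HB Require Import structures.
Require Import Defs.
From mathcomp Require Import all_boot all_order all_algebra.
From mathcomp Require Import boolp.
From mathcomp Require Import mpoly.

(** Write x^m for the class of a monomial in k[Delta]; it vanishes exactly when
the support of m is not a face ([sr_pi_monomial_eq0]).  Nonvanishing is seen by
evaluating at the 0/1 indicator point of a face, which is a zero of the whole
Stanley-Reisner ideal.

Let D be a nonzero homogeneous derivation of degree alpha.  Being determined by
its values on the variables, it is nonzero on one of them.

- If alpha is nonnegative, put w = x^alpha.  Then D x_j = c_j x_j w for scalars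
  c_j, so D acts on monomials by a logarithmic derivative: D x^m is
  (sum_j m_j c_j) x^m w.  In particular D w = s w^2 with s = sum_j alpha_j c_j,
  and the l-th iterate of D maps x_j to
  c_j (c_j + s) ... (c_j + (l - 1) s) x_j w^l.  Local nilpotency makes each c_j
  equal to - t_j s for a natural number t_j; substituting into s gives
  (1 + sum_j alpha_j t_j) s = 0, so s = 0 in characteristic zero, hence every
  c_j, and D itself, is zero ([degree_not_nonneg]).

- If alpha_i < 0, then x_j is killed for every j other than i, for lack of a
  monomial of the required degree.  So D x_i = c x^beta with c nonzero and
  beta = alpha + e_i, which forces alpha_i = -1 and supp beta to be a face.  If
  a facet F contained supp beta but not i, then x_i x^F = 0, while
  D (x_i x^F) = c x^beta x^F is nonzero: a contradiction.  Hence
  alpha = beta - e_i is a Demazure root ([negative_degree_is_root]).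

Conversely a Demazure root beta - e_i is the degree of x^beta times the partial
derivative along x_i.  The root condition says that adding i to a face that
contains supp beta keeps it a face, which makes this operator preserve the
Stanley-Reisner ideal; since beta_i = 0, each application lowers the exponent of
x_i, whence local nilpotency ([root_derivationP]).

The combinatorial description of the roots is a rewriting of the closure
condition as an inclusion of sets of facets ([mem_roots_support]). *)

Set Implicit Arguments.
Unset Strict Implicit.
Unset Printing Implicit Defensive.

Import Order.TTheory GRing.Theory Num.Theory.
Local Open Scope ring_scope.

(** * Exponents as monomials and as integer vectors *)

Section ExponentVectors.
Variable n : nat.
Implicit Types (m : 'X_{1..n}) (a : 'rV[int]_n).

Definition mnm_supp m : {set 'I_n} := [set i | m i != 0%N].

Definition mnm_of a : 'X_{1..n} := [multinom absz (a 0%R i) | i < n].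

Definition vec m : 'rV[int]_n := \row_i (m i)%:Z.

Lemma vecK m : mnm_of (vec m) = m.
Proof. by apply/mnmP => i; rewrite mnmE mxE absz_nat. Qed.

Lemma vec_ge0 m : nonneg (vec m).
Proof. by apply/forallP => i; rewrite mxE. Qed.

Lemma mnm_ofK a : nonneg a -> vec (mnm_of a) = a.
Proof.
move=> /forallP a0; apply/rowP => i; rewrite mxE mnmE.
by rewrite gez0_abs ?a0.
Qed.

Lemma supp_vec m : supp (vec m) = mnm_supp m.
Proof. by apply/setP => i; rewrite !inE mxE. Qed.

Lemma vecD m m' : vec (m + m')%MM = vec m + vec m'.
Proof. by apply/rowP => i; rewrite !mxE mnmDE PoszD. Qed.

Lemma vecU i : vec U_(i)%MM = unit_vec i.
Proof. by apply/rowP => j; rewrite !mxE mnm1E eqxx eq_sym natz. Qed.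

Lemma mnm_suppU i : mnm_supp U_(i)%MM = [set i].
Proof. by apply/setP => j; rewrite !inE mnm1E eqb0 negbK [RHS]eq_sym. Qed.

Lemma mnm_suppD m m' : mnm_supp (m + m')%MM = mnm_supp m :|: mnm_supp m'.
Proof. by apply/setP => j; rewrite !inE mnmDE addn_eq0 negb_and. Qed.

Lemma mnm_supp_mesym1 (S : {set 'I_n}) : mnm_supp (mesym1 S) = S.
Proof. by apply/setP => j; rewrite inE mnmE; case: (j \in S). Qed.

Lemma mnm_supp_mulm m l : mnm_supp (m *+ l)%MM \subset mnm_supp m.
Proof.
by apply/subsetP => j; rewrite !inE mulmnE muln_eq0 negb_or => /andP[].
Qed.

End ExponentVectors.

(** * Facets and the supports of roots *)

Section Facets.
Variables (n : nat) (Delta : simplicial_complex n).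
Implicit Types (S F : {set 'I_n}) (i : 'I_n).

Lemma facets_overP S F :
  reflect [/\ F \in faces Delta,
              forall T, T \in faces Delta -> F \subset T -> T = F & S \subset F]
          (F \in facets_over Delta S).
Proof.
rewrite !inE; apply: (iffP andP) => [[/maxsetP[? ?] ?]|[? ? ?]]; split => //.
by apply/maxsetP.
Qed.

Lemma face_in_facet S :
  S \in faces Delta -> exists F, F \in facets_over Delta S.
Proof.
move=> SD; have [F maxF SF] := @maxset_exists _ (mem (faces Delta)) S SD.
by exists F; rewrite !inE SF andbT.
Qed.

Lemma facets_over_neq0 S : (facets_over Delta S != set0) = (S \in faces Delta).
Proof.
apply/set0Pn/idP => [[F /facets_overP[FD _ SF]]|/face_in_facet //].
exact: face_subset SF FD.
Qed.

Lemma mem_cl S i :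
  (i \in cl Delta S) = (facets_over Delta S \subset facets_over Delta [set i]).
Proof.
apply/bigcapP/subsetP => h F FS.
  by have := FS; rewrite !inE sub1set => /andP[-> _]; rewrite h.
by have := h F FS; rewrite !inE sub1set => /andP[].
Qed.

Lemma mem_roots_support S i :
  (S \in roots_support Delta i) =
  [&& i \notin S, S \in faces Delta
    & facets_over Delta S \subset facets_over Delta [set i]].
Proof. by rewrite inE subsetC sub1set inE mem_cl. Qed.

(** Any facet containing S and T contains i, because it contains S.  This is the
form in which the root condition makes the root derivation well defined. *)
Lemma roots_support_link S T i :
  S \in roots_support Delta i -> S :|: T \in faces Delta ->
  i |: T \in faces Delta.
Proof.
rewrite mem_roots_support => /and3P[_ _ /subsetP h].
move=> /face_in_facet[F /facets_overP[FD Fmax /[!subUset] /andP[SF TF]]].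
have /h/facets_overP[_ _ iF] : F \in facets_over Delta S.
  by apply/facets_overP.
by apply: face_subset FD; rewrite subUset iF.
Qed.

End Facets.

(** * Monomials of the Stanley-Reisner ring *)

Section StanleyReisnerRing.
Variables (k : fieldType) (n : nat) (Delta : simplicial_complex n).
Local Notation A := (sr_ring k Delta).
Local Notation pi := (@sr_pi k n Delta).
Implicit Types (p q : {mpoly k[n]}) (m : 'X_{1..n}) (f : A).

Fact sr_pi_is_zmod_morphism : zmod_morphism pi.
Proof. by move=> p q; rewrite /sr_pi rmorphB. Qed.

HB.instance Definition _ :=
  GRing.isZmodMorphism.Build {mpoly k[n]} A pi sr_pi_is_zmod_morphism.

Fact sr_pi_is_monoid_morphism : monoid_morphism pi.
Proof. by split=> [|p q]; rewrite /sr_pi ?rmorph1 ?rmorphM. Qed.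

HB.instance Definition _ :=
  GRing.isMonoidMorphism.Build {mpoly k[n]} A pi sr_pi_is_monoid_morphism.

Fact sr_pi_is_scalable : scalable pi.
Proof. by move=> c p; rewrite -mul_mpolyC rmorphM. Qed.

HB.instance Definition _ :=
  GRing.isScalable.Build k {mpoly k[n]} A *:%R pi sr_pi_is_scalable.

Lemma sr_pi_surj f : exists p, f = pi p.
Proof. by exists (repr f); rewrite /sr_pi reprK. Qed.

Lemma sr_pi_eq0 p : (pi p == 0) = (p \in @sr_ideal k n Delta).
Proof.
rewrite -(raddf0 pi) -[p in RHS]subr0 Quotient.idealrBE.
exact: erefl.
Qed.

Lemma prod_variables (S : {set 'I_n}) : \prod_(i in S) 'X_i = 'X_[k, mesym1 S].
Proof.
rewrite mprodXE; congr ('X_[_]); apply/mnmP => i.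
rewrite mnmE mnm_sumE big_mkcond (bigD1 i) //= mnm1E eqxx big1 ?addn0.
  by case: (i \in S).
by move=> j /negPf ji; rewrite mnm1E ji; case: ifP.
Qed.

Lemma sr_pi_nonface_mesym1 (S : {set 'I_n}) :
  S \notin faces Delta -> pi 'X_[mesym1 S] = 0.
Proof.
move=> SD; apply/eqP; rewrite sr_pi_eq0; apply/asboolP.
exists (fun T => (T == S)%:R).
rewrite (bigD1 S) //= eqxx mul1r [X in _ + X]big1 ?addr0; last first.
  by move=> T /andP[_ /negPf->]; rewrite mul0r.
by rewrite prod_variables.
Qed.

(** The indicator point of a face lies on the coordinate subspace of that face,
hence in the variety of the Stanley-Reisner ideal; evaluation there separates
monomials supported on the face from zero. *)
Definition face_point (F : {set 'I_n}) (i : 'I_n) : k := (i \in F)%:R.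

Lemma meval_face_point F m :
  'X_[k, m].@[face_point F] = (mnm_supp m \subset F)%:R.
Proof.
rewrite mevalX /face_point; case: subsetP => mF /=.
  apply: big1 => i _; have := mF i; rewrite inE.
  by case: (m i) => [|d] iF; rewrite ?expr0 // iF // expr1n.
have [i mi iF] : exists2 i, i \in mnm_supp m & i \notin F.
  by apply/subsetPn/subsetP.
move: mi; rewrite inE => mi; rewrite (bigD1 i) //= (negPf iF).
by rewrite expr0n (negPf mi) mul0r.
Qed.

Lemma sr_ideal_vanishes F p :
  F \in faces Delta -> pi p = 0 -> p.@[face_point F] = 0.
Proof.
move=> FD /eqP; rewrite sr_pi_eq0 => /asboolP[q ->].
rewrite raddf_sum big1 // => S SD /=.
have [i iS iF] : exists2 i, i \in S & i \notin F.
  by apply/subsetPn; apply: contra SD => /face_subset/(_ FD).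
by rewrite mevalM (bigD1 i) //= mevalM mevalXU /face_point (negPf iF) mul0r mulr0.
Qed.

Lemma sr_pi_monomial_eq0 m : (pi 'X_[m] == 0) = (mnm_supp m \notin faces Delta).
Proof.
apply/eqP/idP => [m0|].
  apply/negP => /sr_ideal_vanishes/(_ m0)/eqP.
  by rewrite meval_face_point subxx oner_eq0.
set S := mnm_supp m => /sr_pi_nonface_mesym1 S0.
rewrite -[m](@submK _ (mesym1 S)) ?mpolyXD ?rmorphM /= ?S0 ?mulr0 //.
apply/mnm_lepP => i; rewrite mnmE inE.
by case: (m i).
Qed.

Lemma sr_ring_ind (P : A -> Prop) :
  P 0 -> (forall c m f, P f -> P (c *: pi 'X_[m] + f)) -> forall f, P f.
Proof.
move=> P0 PD f; have [p ->] := sr_pi_surj f.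
elim/mpolyind: p => [|c m p _ _ IHp]; first by rewrite raddf0.
by rewrite linearP; apply: PD.
Qed.

(** A uniform description of the graded pieces, without a case distinction on
faces: when the support is not a face, the monomial itself is zero. *)
Lemma graded_piece_vec m f :
  graded_piece (vec m) f <-> exists c : k, f = c *: pi 'X_[m].
Proof.
rewrite /graded_piece vec_ge0 supp_vec /sr_monomial -/(mnm_of _) vecK /=.
case: ifPn => [//|]; rewrite -sr_pi_monomial_eq0 => /eqP ->.
by split=> [->|[c ->]]; [exists 0|]; rewrite scaler0.
Qed.

Lemma graded_piece_neg (a : 'rV[int]_n) i f :
  a 0 i < 0 -> graded_piece a f -> f = 0.
Proof.
move=> ai; rewrite /graded_piece; case: (boolP (nonneg a)) => //= /forallP.
by move=> /(_ i); rewrite leNgt ai.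
Qed.

Lemma graded_piece0 (a : 'rV[int]_n) : graded_piece a (0 : A).
Proof.
by rewrite /graded_piece; case: ifP => // _; exists 0; rewrite scale0r.
Qed.

End StanleyReisnerRing.

(** * Degrees of homogeneous derivations *)

Section HomogeneousDerivations.
Variables (k : fieldType) (n : nat) (Delta : simplicial_complex n).
Local Notation A := (sr_ring k Delta).
Local Notation pi := (@sr_pi k n Delta).
Variable D : {linear A -> A}.
Hypothesis derD : derivation D.
Implicit Types (m b : 'X_{1..n}) (f g w : A).

(** When f is invertible this says that the logarithmic derivative D f / f is
a w.  As with logarithmic derivatives, the scalars a add up under products.
The case w = 0 expresses that D kills f. *)
Definition log_derivative w f (a : k) : Prop := D f = a *: (f * w).

Lemma log_derivative1 w : log_derivative w 1 0.
Proof.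
rewrite /log_derivative scale0r; apply: (addrI (D 1)).
by have := derD 1 1; rewrite !mulr1 mul1r addr0.
Qed.

Lemma log_derivativeM w f g (a b : k) :
  log_derivative w f a -> log_derivative w g b ->
  log_derivative w (f * g) (a + b).
Proof.
rewrite /log_derivative derD => -> ->.
by rewrite scalerDl -scalerAl -scalerAr mulrAC mulrA.
Qed.

Lemma log_derivativeX w f a l :
  log_derivative w f a -> log_derivative w (f ^+ l) (l%:R * a).
Proof.
move=> fa; elim: l => [|l IHl].
  by rewrite mul0r expr0; apply: log_derivative1.
rewrite exprS -natr1 mulrDl mul1r addrC.
exact: log_derivativeM.
Qed.

Lemma log_derivative_monomial w (c : 'I_n -> k) m :
  (forall j, j \in mnm_supp m -> log_derivative w (pi 'X_j) (c j)) ->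
  log_derivative w (pi 'X_[m]) (\sum_j (m j)%:R * c j).
Proof.
move=> Xc; rewrite mpolyXE_id rmorph_prod.
apply: (big_rec2 (fun a f => log_derivative w f a)).
  exact: log_derivative1.
move=> j a f _ fa; rewrite rmorphXn; apply: log_derivativeM => //.
case mj: (m j) => [|d]; first by rewrite mul0r; apply: log_derivative1.
by apply: log_derivativeX; apply: Xc; rewrite inE mj.
Qed.

(** D multiplies f w^l by (a + l s) w, so the iterates produce an arithmetic progression of factors.  It terminates at zero only if
a is a nonpositive integral multiple of s, or if f w^l itself vanishes. *)
Lemma iter_log_derivative w f s a l :
  log_derivative w w s -> log_derivative w f a ->
  iter l D f = (\prod_(t < l) (a + t%:R * s)) *: (f * w ^+ l).
Proof.
move=> ws fa; elim: l => [|l IHl].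
  by rewrite big_ord0 scale1r mulr1.
have := log_derivativeM fa (log_derivativeX l ws).
rewrite iterS IHl linearZ /log_derivative /= => ->.
by rewrite scalerA big_ord_recr /= exprSr mulrA.
Qed.

Lemma derivation_monomial_eq0 m :
  (forall j, j \in mnm_supp m -> D (pi 'X_j) = 0) -> D (pi 'X_[m]) = 0.
Proof.
move=> X0; have := @log_derivative_monomial 0 (fun=> 0) m.
rewrite /log_derivative mulr0 scaler0; apply=> j jm.
by rewrite mulr0 scaler0 X0.
Qed.

Lemma derivation_eq0 : (forall j, D (pi 'X_j) = 0) -> forall f, D f = 0.
Proof.
move=> X0; apply: sr_ring_ind => [|c m f IHf]; first exact: linear0.
by rewrite linearP IHf derivation_monomial_eq0 // scaler0 addr0.
Qed.

Hypothesis D_neq0 : exists f, D f != 0.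

Lemma nonzero_on_variable : exists i, D (pi 'X_i) != 0.
Proof.
apply/existsP; apply: contraPT D_neq0 => /existsPn X0 [f /eqP[]].
by apply: derivation_eq0 => j; apply/eqP/negPn/X0.
Qed.

Variable alpha : 'rV[int]_n.
Hypothesis homD : homogeneous alpha D.

Lemma homogeneous_monomial m : graded_piece (vec m + alpha) (D (pi 'X_[m])).
Proof. by apply: homD; apply/graded_piece_vec; exists 1; rewrite scale1r. Qed.

Lemma homogeneous_kills m i :
  (m i)%:Z + alpha 0 i < 0 -> D (pi 'X_[m]) = 0.
Proof.
move=> mi; apply: (graded_piece_neg (i := i)) (homogeneous_monomial m).
by rewrite !mxE.
Qed.

(** Nilpotency on x_j makes c_j a nonpositive integral multiple of s.  As s is a
nonnegative integral combination of the c_j, it is a nonpositive integral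
multiple of itself, hence zero in characteristic zero. *)
Lemma degree_not_nonneg :
  [pchar k] =i pred0 -> locally_nilpotent D -> nonneg alpha -> False.
Proof.
move=> char0 nilD alpha0; set b := mnm_of alpha; set w := pi 'X_[b].
(* The scalar is not determined when [x_j w] vanishes; it is then chosen
   to be zero, since nilpotency on [x_j] gives no information about it. *)
have Xa j : exists a : k,
    log_derivative w (pi 'X_j) a /\ (pi 'X_j * w = 0 -> a = 0).
  have := homogeneous_monomial U_(j)%MM.
  rewrite -(mnm_ofK alpha0) -vecD => /graded_piece_vec[a].
  rewrite /log_derivative mpolyXD rmorphM /= -/w => ->.
  case: (eqVneq (pi 'X_j * w) 0) => [->|nz]; last first.
    by exists a; split=> // z; rewrite z eqxx in nz.
  by exists 0; rewrite !scaler0.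
have [c Xc] := boolp.choice Xa.
set s := \sum_j (b j)%:R * c j.
have ws : log_derivative w w s.
  by apply: log_derivative_monomial => j _; case: (Xc j).
(* A nonzero [c_j] comes with a face [supp b] with [j] added, so all the
   [x_j w^l] are nonzero and the scalar factor of some iterate must vanish. *)
have cs j : exists t : nat, c j = - (t%:R * s).
  case: (eqVneq (c j) 0) => [->|cj0]; first by exists 0%N; rewrite mul0r oppr0.
  have [l [_]] := nilD (pi 'X_j).
  rewrite (iter_log_derivative l ws (Xc j).1) => /eqP.
  rewrite scaler_eq0; case/orP => [/prodf_eq0[t _ ]|].
    by rewrite addr_eq0 => /eqP ->; exists t.
  rewrite -rmorphXn -rmorphM mpolyXn -mpolyXD sr_pi_monomial_eq0 => /negP[].
  apply: (@face_subset _ _ (mnm_supp (U_(j) + b)%MM)).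
    by rewrite !mnm_suppD setUS ?mnm_supp_mulm.
  rewrite -[_ \in _]negbK -(sr_pi_monomial_eq0 k) mpolyXD rmorphM.
  by apply: contraNN cj0 => /eqP/(Xc j).2 ->.
have [t ct] := boolp.choice cs.
have s0 : s = 0.
  have : (1 + \sum_j b j * t j)%N%:R * s = 0.
    rewrite natrD mulrDl mul1r natr_sum {1}/s mulr_suml -big_split big1 //= => j _.
    by rewrite ct natrM mulrN mulrA addNr.
  move/eqP; rewrite mulf_eq0 => /orP[|/eqP //].
  by move/pcharf0P: char0 => ->.
have [i /negP[]] := nonzero_on_variable.
by rewrite (Xc i).1 ct s0 mulr0 oppr0 scale0r.
Qed.

(** The closure condition comes from applying D to the relation x_i x^F = 0,
where F is a facet that contains supp beta and avoids i. *)
Lemma negative_degree_is_root i : alpha 0 i < 0 -> demazure_root Delta alpha.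
Proof.
move=> ai; have Dj0 j : j != i -> D (pi 'X_j) = 0.
  by move=> ji; apply: (homogeneous_kills (i := i)); rewrite mnm1E (negPf ji) add0r.
have Di : D (pi 'X_i) != 0.
  have [j Dj] := nonzero_on_variable.
  by have [<- //|/Dj0 z] := eqVneq j i; rewrite z eqxx in Dj.
set beta := vec U_(i)%MM + alpha.
have beta0 : nonneg beta.
  apply/forallP => j; rewrite leNgt; apply: contra Di => bj.
  by apply/eqP/(homogeneous_kills (i := j)); move: bj; rewrite !mxE.
have bi : beta 0 i = 0.
  have := forallP beta0 i; rewrite !mxE mnm1E eqxx => bi0.
  by apply/eqP; rewrite eq_le bi0 andbT -ltzD1 addrC ltrD2r.
set b := mnm_of beta; have bE : vec b = beta by apply: mnm_ofK.
have [c Dc] : exists c : k, D (pi 'X_i) = c *: pi 'X_[b].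
  by apply/graded_piece_vec; rewrite bE; apply: homogeneous_monomial.
have : c *: pi 'X_[b] != 0 by rewrite -Dc.
rewrite scaler_eq0 negb_or sr_pi_monomial_eq0 negbK => /andP[c0 bD].
exists i, beta; split=> //; last by rewrite /beta vecU addrAC subrr add0r.
rewrite -bE supp_vec mem_roots_support bD inE mnmE bi /=.
apply/subsetP => F /facets_overP[FD Fmax bF]; apply/facets_overP; split=> //.
rewrite sub1set; apply: contraT => iF.
(* [x^F] does not involve [x_i], the only variable on which [D] is nonzero. *)
have DF0 : D (pi 'X_[mesym1 F]) = 0.
  apply: derivation_monomial_eq0 => j; rewrite mnm_supp_mesym1 => jF.
  by apply: Dj0; apply: contraNneq iF => <-.
have iFD : i |: F \notin faces Delta.
  by apply: contra iF => /Fmax/(_ (subsetUr _ _)) <-; apply: setU11.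
have := derD (pi 'X_i) (pi 'X_[mesym1 F]).
rewrite DF0 mulr0 addr0 -rmorphM -mpolyXD Dc -scalerAl -rmorphM -mpolyXD /=.
have /eqP-> : pi 'X_[U_(i) + mesym1 F] == 0.
  by rewrite sr_pi_monomial_eq0 mnm_suppD mnm_suppU mnm_supp_mesym1.
rewrite linear0 => /esym/eqP; rewrite scaler_eq0 (negPf c0) sr_pi_monomial_eq0.
by rewrite mnm_suppD mnm_supp_mesym1 (setUidPr bF) FD.
Qed.

End HomogeneousDerivations.

(** * The derivation attached to a root *)

Section RootDerivation.
Variables (k : fieldType) (n : nat) (Delta : simplicial_complex n).
Local Notation A := (sr_ring k Delta).
Local Notation pi := (@sr_pi k n Delta).

Lemma sr_descend (phi : {mpoly k[n]} -> {mpoly k[n]}) :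
  linear phi -> (forall p, pi p = 0 -> pi (phi p) = 0) ->
  exists D : {linear A -> A}, forall p, D (pi p) = pi (phi p).
Proof.
move=> lin_phi phi0; pose d (f : A) : A := pi (phi (repr f)).
have dE p : d (pi p) = pi (phi p).
  apply/eqP; rewrite -subr_eq0 -rmorphB /=.
  rewrite addrC -scaleN1r -lin_phi.
  apply/eqP/phi0; rewrite linearP /= scaleN1r /sr_pi reprK.
  exact: addNr.
have lin_d : linear d.
  move=> c f g; have [p ->] := sr_pi_surj f; have [q ->] := sr_pi_surj g.
  by rewrite -linearP !dE lin_phi linearP.
pose L := GRing.isLinear.Build k A A *:%R d lin_d.
by exists (HB.pack_for {linear A -> A} d L).
Qed.

Variables (i : 'I_n) (b : 'X_{1..n}).
Implicit Types m : 'X_{1..n}.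
Hypothesis b_root : mnm_supp b \in roots_support Delta i.

Lemma root_shift_nonface m :
  m i != 0%N -> mnm_supp m \notin faces Delta ->
  mnm_supp (b + (m - U_(i)))%MM \notin faces Delta.
Proof.
move=> mi; apply: contra; rewrite mnm_suppD => /(roots_support_link b_root).
apply: face_subset; apply/subsetP => j; rewrite !inE mnmBE mnm1E.
by case: (eqVneq j i) => //= ji; rewrite subn0.
Qed.

(** The ideal is preserved by the Leibniz rule on a multiple q x^S of a generator:
one term stays a multiple of x^S, in the other x^S is replaced by
x^beta x^(S \ i), whose support is still not a face by [root_shift_nonface]. *)
Lemma root_derivation_exists : exists D : {linear A -> A},
  forall p, D (pi p) = pi ('X_[b] * mderiv i p).
Proof.
apply: (@sr_descend (fun p => 'X_[b] * mderiv i p)) => [c p q|p /eqP].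
  by rewrite linearP mulrDr scalerAr.
rewrite sr_pi_eq0 => /asboolP[q ->].
rewrite linear_sum mulr_sumr raddf_sum big1 // => S SD /=.
rewrite prod_variables mderivM !(mulrDr, rmorphD, rmorphM) /=.
rewrite sr_pi_nonface_mesym1 // !mulr0 add0r mulrCA -rmorphM mderivX.
rewrite -scalerAr -mpolyXD /=. rewrite linearZ /=.
have [->|mi] := eqVneq (mesym1 S i) 0%N; first by rewrite scale0r mulr0.
have /eqP-> : pi 'X_[b + (mesym1 S - U_(i))] == 0.
  by rewrite sr_pi_monomial_eq0 root_shift_nonface ?mnm_supp_mesym1.
by rewrite scaler0 mulr0.
Qed.

Lemma root_derivationP : exists D : {linear A -> A},
  [/\ derivation D, (exists f, D f != 0),
      homogeneous (vec b - unit_vec i) D & locally_nilpotent D].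
Proof.
have [D DE] := root_derivation_exists.
have [ib bD _] := and3P (etrans (esym (mem_roots_support _ _ _)) b_root).
have DX m : D (pi 'X_[m]) = (m i)%:R *: pi 'X_[b + (m - U_(i))].
  by rewrite DE mderivX -scalerAr -mpolyXD linearZ.
exists D; split.
- move=> f g; have [p ->] := sr_pi_surj f; have [q ->] := sr_pi_surj g.
  rewrite -rmorphM !DE -!rmorphM -rmorphD mderivM mulrDr /=.
  by rewrite (mulrCA p) !mulrA.
- exists (pi 'X_i); rewrite DX mnm1E eqxx scale1r sr_pi_monomial_eq0 negbK.
  rewrite (_ : _ + _ = b)%MM //; apply/mnmP => j.
  by rewrite mnmDE mnmBE subnn addn0.
- move=> a f; case: (boolP (nonneg a)) => [a0|aN]; last first.
    rewrite {1}/graded_piece (negPf aN) => ->.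
    by rewrite linear0; apply: graded_piece0.
  rewrite -(mnm_ofK a0); set m := mnm_of a => /graded_piece_vec[c ->].
  rewrite linearZ DX /=; have [->|mi] := eqVneq (m i) 0%N.
    by rewrite scale0r scaler0; apply: graded_piece0.
  have -> : vec m + (vec b - unit_vec i) = vec (b + (m - U_(i)))%MM.
    rewrite -vecU; apply: (addIr (vec U_(i)%MM)).
    by rewrite addrA subrK -!vecD -addmA submK ?lep1mP // addmC.
  by apply/graded_piece_vec; exists (c * (m i)%:R); rewrite scalerA.
have iterD0 l : iter l D 0 = 0.
  by elim: l => //= l ->; rewrite linear0.
have iterP l c f g : iter l D (c *: f + g) = c *: iter l D f + iter l D g.
  by elim: l => //= l ->; rewrite linearP.
(* As [b] does not involve [i], each application of [D] lowers the exponent of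
   [x_i] by one. *)
have iterX l : forall m, (m i < l)%N -> iter l D (pi 'X_[m]) = 0.
  elim: l => // l IHl m; rewrite ltnS iterSr DX.
  have [-> _|mi ml] := eqVneq (m i) 0%N; first by rewrite scale0r iterD0.
  rewrite -[_ *: _]addr0 iterP iterD0 addr0 IHl ?scaler0 //.
  move: ib; rewrite inE negbK mnmDE mnmBE mnm1E eqxx => /eqP->.
  by rewrite add0n subn1; case: (m i) mi ml.
apply: sr_ring_ind => [|c m f [l [_ lf]]]; first by exists 1%N; rewrite iterD0.
exists (l + (m i).+1)%N; split; first by rewrite addnS.
rewrite iterP iterD iterX // iterD0 scaler0 add0r addnC iterD lf.
exact: iterD0.
Qed.

End RootDerivation.

(** * Degrees of locally nilpotent derivations are the Demazure roots *)

Theorem theorem3p7 (k : closedFieldType) (char0 : [pchar k] =i pred0)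
    (n : nat) (n_gt0 : (0 < n)%N) (Delta : simplicial_complex n) :
  (forall alpha : 'rV[int]_n,
     (exists D : {linear sr_ring k Delta -> sr_ring k Delta},
        [/\ derivation D, (exists f, D f != 0), homogeneous alpha D
          & locally_nilpotent D])
     <-> demazure_root Delta alpha)
  /\
  (forall alpha : 'rV[int]_n,
     demazure_root Delta alpha <->
     exists (i : 'I_n) (beta : 'rV[int]_n),
       [/\ nonneg beta, beta 0 i = 0,
           facets_over Delta (supp beta) != set0
             /\ facets_over Delta (supp beta) \subset facets_over Delta [set i]
         & alpha = beta - unit_vec i]).
Proof.
split=> alpha; split.
- case=> D [derD D0 homD nilD]; have [a0|] := boolP (nonneg alpha).
    by have := degree_not_nonneg derD D0 homD char0 nilD a0.
  case/forallPn => i; rewrite -ltNge => ai.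
  exact: (negative_degree_is_root derD D0 homD ai).
- case=> i [beta [beta0 _ b_root ->]].
  rewrite -(mnm_ofK beta0); apply: root_derivationP.
  by rewrite -supp_vec mnm_ofK.
- case=> i [beta [beta0 bi + ->]]; rewrite mem_roots_support => /and3P[_ bD bF].
  by exists i, beta; rewrite facets_over_neq0.
- case=> i [beta [beta0 bi [+ bF] ->]]; rewrite facets_over_neq0 => bD.
  by exists i, beta; rewrite mem_roots_support bD bF inE bi eqxx.
Qed.
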